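(* Let $(X^0,U^0)\in\mathbb C(\mathcal{COP}(p))$ with $T_a(X^0)\ne\emptyset$. Let $U^0(s)$, $s\in S$, be matrices with $$U^0=\sum_{s\in S}U^0(s),\qquad U^0(s)\in\mathcal F(s)\ \ \forall s\in S.$$ Suppose that Assumption jj) holds and that for all $s\in S$ $$\mathcal A(X^0,s)\in\mathbb S_+(p(s)),\quad \mathcal A(U^0(s),s)\in\mathbb S_+(p(s)),\quad \mathcal A(X^0,s)+\mathcal A(U^0(s),s)\in\mathrm{int}\,\mathbb S_+(p(s)).$$ Let $p_*(s)=p(s)(p(s)+1)/2$, $p_*=p(p+1)/2$, $m=\sum_{s\in S}p_*(s)$. For $X\in\mathbb S(p)$ and $W(s)\in\mathbb S(p(s))$, $s\in S$, let $$z=\big(\mathrm{svec}(X);\ \mathrm{svec}(W(s)),\,s\in S\big)\in\mathbb R^{p_*+m},\qquad z^0=\big(\mathrm{svec}(X^0);\ \mathrm{svec}(\mathcal A(U^0(s),s)),\,s\in S\big)\in\mathbb R^{p_*+m},$$ $$\Omega(z,s)=\mathrm{svec}\big(\mathcal A(X,s)W(s)+W(s)\mathcal A(X,s)\big)\in\mathbb R^{p_*(s)},\qquad \Omega(z)=\big(\Omega(z,s),\,s\in S\big)\in\mathbb R^m$$ (all stacked as column vectors). Then the Jacobian matrix $\frac{\partial\Omega(z^0)}{\partial z}\in\mathbb R^{m\times(p_*+m)}$ has full row rank: $\mathrm{rank}\,\frac{\partial\Omega(z^0)}{\partial z}=m$.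
   Context: Let $p$ be a positive integer, $P=\{1,\dots,p\}$, $e_1,\dots,e_p$ the standard basis of $\mathbb R^p$, and $\mathbb R^p_+$ the nonnegative orthant. $\mathbb S(q)$ is the space of real symmetric $q\times q$ matrices with inner product $X\bullet U=\mathrm{trace}(XU)$; $\mathbb S_+(q)$ is the cone of positive semidefinite matrices and $\mathrm{int}\,\mathbb S_+(q)$ its interior (positive definite matrices). For $F\in\mathbb S(q)$, $\mathrm{svec}(F)=(F_{11},\sqrt2F_{21},\dots,\sqrt2F_{q1},F_{22},\sqrt2F_{32},\dots,\sqrt2F_{q2},\dots,F_{qq})^\top\in\mathbb R^{q(q+1)/2}$. $\|t\|_1=\sum_k|t_k|$, $\mathrm{supp}(t)=\{k\in P:t_k\ne0\}$, $T=\{t\in\mathbb R^p_+:\|t\|_1=1\}$. $\mathcal{COP}(p)=\{D\in\mathbb S(p):t^\top Dt\ge0\ \forall t\in\mathbb R^p_+\}$, $\mathcal{CP}(p)=\mathrm{cone}\{tt^\top:t\in\mathbb R^p_+\}$ (cone = conic hull), and $\mathbb C(\mathcal{COP}(p))=\{(X,U):X\in\mathcal{COP}(p),\,U\in\mathcal{CP}(p),\,X\bullet U=0\}$. Data attached to $X^0\in\mathcal{COP}(p)$. $T_a(X^0)=\{t\in T:t^\top X^0t=0\}$ (empty or a finite union of bounded convex polyhedra), assumed nonempty. $\tau(j)$, $j\in J\subset\mathbb N$, are all the vertices of $\mathrm{conv}\,T_a(X^0)$, and $M(j)=\{k\in P:e_k^\top X^0\tau(j)=0\}$. The (finite) set $J$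 is divided into the maximum number of (possibly overlapping) subsets $J(s)$, $s\in S\subset\mathbb N$, $|S|\ge1$, such that: a) $J=\bigcup_{s\in S}J(s)$; b) for every $s\in S$, $\bigcup_{j\in J(s)}\mathrm{supp}(\tau(j))\subset M(i)$ for all $i\in J(s)$; c) if $|S|\ge2$, then for all $s,\bar s\in S$ with $s\ne\bar s$: $J(s)\setminus J(\bar s)\ne\emptyset$, $J(\bar s)\setminus J(s)\neq\emptyset$, and for every $i_0\in J(s)\setminus J(\bar s)$ there exist $j_0\in J(\bar s)\setminus J(s)$ and $k_0\in\mathrm{supp}(\tau(i_0))$ with $k_0\notin M(j_0)$. It is known that then $T_a(X^0)=\bigcup_{s\in S}T_a(s,X^0)$, where $T_a(s,X^0)=\mathrm{conv}\{\tau(j):j\in J(s)\}$. Put $P_*(s)=\bigcup_{j\in J(s)}\mathrm{supp}(\tau(j))$, $p(s)=|P_*(s)|$, and $\mathcal F(s)=\mathrm{cone}\{tt^\top:t\in T_a(s,X^0)\}\subset\mathcal{CP}(p)$. Since $X^0\bullet U^0=0$, a decomposition $U^0=\sum_{s\in S}U^0(s)$ with $U^0(s)\in\mathcal F(s)$ always exists. For a set $I\subset\mathbb N$, $V(I)=\{(i,j):i,j\in I,\ i\le j\}$. For $s\in S$, $J_b(s)\subset J(s)$ is such that $\{\tau(j):j\in J_b(s)\}$ is a basis of $\mathrm{span}\{\tau(j):j\in J(s)\}$. For $X\in\mathbb S(p)$, $\mathcal A(X,s)\in\mathbb S(p(s))$ is the principal submatrix of $X$ with rows and columns indexed by $P_*(s)$.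 Assumption jj): the family of matrices $(\tau(i)+\tau(j))(\tau(i)+\tau(j))^\top$, $(i,j)\in V(J_b(s))$, $s\in S$ (indexed by all $s$ and $(i,j)$), is linearly independent. *)

(* Defs.v *)
From HB Require Import structures.
From mathcomp Require Import all_boot all_order all_algebra.
From mathcomp Require Import all_classical all_reals all_analysis.

Set Implicit Arguments.
Unset Strict Implicit.
Unset Printing Implicit Defensive.

Import Order.TTheory GRing.Theory Num.Theory.
Import numFieldNormedType.Exports.

Local Open Scope ring_scope.

Section Convexity.
Variables (R : realType) (V : lmodType R).

Definition conv_hull (A : set V) : set V := smallest (@convex_set R V) A.

Definition conic_hull (A : set V) : set V :=
  [set x | exists n (c : 'I_n -> R) (a : 'I_n -> V),
     [/\ forall i, 0 <= c i, forall i, A (a i) & x = \sum_i c i *: a i]]%classic.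

(* The vertices of a polytope C are its extreme points. *)
Definition vertex (C : set V) : set V :=
  [set x | C x /\
     forall y z (l : R), C y -> C z -> 0 < l < 1 ->
       x = l *: y + (1 - l) *: z -> y = x /\ z = x]%classic.

End Convexity.

Section SymmetricMatrices.
Variable R : realType.

Definition qform q (A : 'M[R]_q) (t : 'cV[R]_q) : R := (t^T *m A *m t) 0 0.

Definition psdmx q (A : 'M[R]_q) : Prop :=
  A \is symmetricmx /\ forall t, 0 <= qform A t.

(* The interior of the cone psdmx in the space of symmetric matrices. *)
Definition posdefmx q (A : 'M[R]_q) : Prop :=
  A \is symmetricmx /\ forall t, t != 0 -> 0 < qform A t.

Definition sqcol q (t : 'cV[R]_q) : 'M[R]_q := t *m t^T.

Definition triang (q : nat) : nat := (q * q.+1)./2.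

(* Positions (row, column) of the lower triangle, column by column. *)
Definition lower_pairs q : seq ('I_q * 'I_q) :=
  [seq (i, j) | j : 'I_q <- enum 'I_q, i : 'I_q <- [seq i : 'I_q <- enum 'I_q | (j <= i)%N]].

Lemma size_lower_pairs q : size (lower_pairs q) == triang q.
Proof.
rewrite size_allpairs_dep /triang.
have -> : [seq size [seq i : 'I_q <- enum 'I_q | (x <= i)%N] | x : 'I_q <- enum 'I_q]
        = [seq (q - x)%N | x <- iota 0 q].
  rewrite -val_enum_ord -[RHS]map_comp; apply: eq_map => j /=.
  rewrite size_filter -(count_map val (fun i => (j <= i)%N)) val_enum_ord.
  rewrite -size_filter.
  have -> : iota 0 q = iota 0 j ++ iota j (q - j).
    by rewrite -{1}(subnKC (ltnW (ltn_ord j))) iotaD.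
  rewrite filter_cat size_cat !size_filter.
  rewrite (@eq_in_count _ _ pred0); last first.
    by move=> i; rewrite mem_iota /= add0n => /(leq_trans _) ij; apply/negbTE; rewrite -ltnNge ij.
  rewrite count_pred0 add0n (@eq_in_count _ _ predT) ?count_predT ?size_iota //.
  by move=> i; rewrite mem_iota => /andP[->].
rewrite sumnE big_map -[X in iota 0 X]subn0 -/(index_iota 0 q) big_mkord.
have -> : (\sum_(i < q) (q - i) = \sum_(i < q) i.+1)%N.
  rewrite (reindex_inj rev_ord_inj) /=; apply: eq_bigr => i _.
  by rewrite subKn.
elim: q => [|q IH]; first by rewrite big_ord0.
rewrite (_ : q.+1 * q.+2 = q * q.+1 + q.+1.*2)%N.
  by rewrite big_ord_recr /= (eqP IH) halfD odd_double andbF add0n doubleK.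
by rewrite -[q.+2]addn2 mulnDr muln2 mulnC.
Qed.

Definition lower_tuple q : (triang q).-tuple ('I_q * 'I_q) :=
  Tuple (size_lower_pairs q).

Definition svec_weight q (ij : 'I_q * 'I_q) : R :=
  if ij.1 == ij.2 then 1 else Num.sqrt 2.

Definition svec q (F : 'M[R]_q) : 'rV[R]_(triang q) :=
  \row_k let ij := tnth (lower_tuple q) k in svec_weight ij * F ij.1 ij.2.

(* Inverse of svec on symmetric matrices (svecK, smatK). *)
Definition smat q (v : 'rV[R]_(triang q)) : 'M[R]_q :=
  \matrix_(i, j) \sum_(k | tnth (lower_tuple q) k \in [:: (i, j); (j, i)])
    v 0 k / svec_weight (i, j).

Lemma mem_lower_pairs q (i j : 'I_q) : ((i, j) \in lower_pairs q) = (j <= i)%N.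
Proof.
apply/allpairsPdep/idP => [[j' [i' [_ + [-> ->]]]]|ji].
  by rewrite mem_filter => /andP[].
exists j, i; split=> //; first by rewrite mem_enum.
by rewrite mem_filter ji mem_enum.
Qed.

Lemma mem_lower_tuple q (i j : 'I_q) : ((i, j) \in lower_tuple q) = (j <= i)%N.
Proof. exact: mem_lower_pairs. Qed.

Lemma uniq_lower_pairs q : uniq (lower_pairs q).
Proof.
apply: allpairs_uniq_dep; first exact: enum_uniq.
  by move=> j _; rewrite filter_uniq// enum_uniq.
by move=> [j i] [j' i'] _ _ /= [-> ->].
Qed.

Lemma svec_weight_neq0 q (ij : 'I_q * 'I_q) : svec_weight ij != 0.
Proof. by rewrite /svec_weight; case: ifP; rewrite ?oner_neq0 ?sqrtr_eq0 -?ltNge. Qed.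

Lemma svec_weightC q (i j : 'I_q) : svec_weight (i, j) = svec_weight (j, i).
Proof. by rewrite /svec_weight eq_sym. Qed.

Lemma symmetricmxE q (F : 'M[R]_q) : (F \is symmetricmx) = (F^T == F).
Proof.
by rewrite qualifE /= scale1r map_mx_id // eq_sym.
Qed.

Lemma smat_sym q (v : 'rV[R]_(triang q)) : smat v \is symmetricmx.
Proof.
rewrite symmetricmxE; apply/eqP/matrixP => i j; rewrite !mxE.
by rewrite svec_weightC; apply: eq_bigl => k; rewrite !inE orbC.
Qed.

Lemma tnth_lower_inj q : injective (tnth (lower_tuple q)).
Proof. exact/tuple_uniqP/uniq_lower_pairs. Qed.

Lemma svecK q (F : 'M[R]_q) : F \is symmetricmx -> smat (svec F) = F.
Proof.
rewrite symmetricmxE => /eqP FT; apply/matrixP => i j.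
wlog ji : i j / (j <= i)%N => [wl|].
  case: (leqP j i) => [/wl//|/ltnW /wl sFji].
  have /eqP ST : (smat (svec F))^T == smat (svec F) by rewrite -symmetricmxE smat_sym.
  by rewrite -ST mxE sFji -[in RHS]FT mxE.
have /tnthP[k ek] : (i, j) \in lower_tuple q by rewrite mem_lower_tuple.
rewrite mxE (big_pred1 k) => [|l].
  by rewrite mxE -ek /= mulrAC divff ?mul1r// svec_weight_neq0.
rewrite !inE -(inj_eq (@tnth_lower_inj q)) -ek.
case: eqP => //= ne; apply/negP => /eqP e.
have := mem_tnth l (lower_tuple q); rewrite e mem_lower_tuple => ij.
have ijE : i = j by apply/val_inj/eqP; rewrite eqn_leq ij ji.
by case: ne; rewrite e ijE.
Qed.

Lemma smatK q (v : 'rV[R]_(triang q)) : svec (smat v) = v.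
Proof.
apply/rowP => k; rewrite mxE.
have := mem_tnth k (lower_tuple q).
case ek: (tnth _ k) => [i j] /=; rewrite mem_lower_tuple => ji.
rewrite mxE (big_pred1 k) => [|l].
  by rewrite mulrC divfK// svec_weight_neq0.
rewrite !inE -(inj_eq (@tnth_lower_inj q)) ek.
case: eqP => //= ne; apply/negP => /eqP e.
have := mem_tnth l (lower_tuple q); rewrite e mem_lower_tuple => ij.
have ijE : i = j by apply/val_inj/eqP; rewrite eqn_leq ij ji.
by case: ne; rewrite e ijE.
Qed.

End SymmetricMatrices.

Section CopositiveZeros.
Variables (R : realType) (p : nat).

Definition orthant : set 'cV[R]_p := [set t | forall k, 0 <= t k 0]%classic.

Definition COP : set 'M[R]_p :=
  [set D | D \is symmetricmx /\ forall t, orthant t -> 0 <= qform D t]%classic.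

Definition CP : set 'M[R]_p := conic_hull (@sqcol R p @` orthant)%classic.

Definition complementary_pairs : set ('M[R]_p * 'M[R]_p) :=
  [set XU | [/\ COP XU.1, CP XU.2 & \tr (XU.1 *m XU.2) = 0]]%classic.

Definition simplex : set 'cV[R]_p :=
  [set t | orthant t /\ \sum_k `|t k 0| = 1]%classic.

Definition supp (t : 'cV[R]_p) : {set 'I_p} := [set k | t k 0 != 0]%SET.

Definition zeros (X : 'M[R]_p) : set 'cV[R]_p :=
  [set t | simplex t /\ qform X t = 0]%classic.

(* tau lists the vertices of conv_hull (zeros X), without repetition. *)
Definition vertex_enum (X : 'M[R]_p) n (tau : 'I_n -> 'cV[R]_p) : Prop :=
  injective tau /\ range tau = vertex (conv_hull (zeros X)).

Definition Mset (X : 'M[R]_p) (t : 'cV[R]_p) : {set 'I_p} :=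
  [set k | (X *m t) k 0 == 0]%SET.

Definition Pstar n (tau : 'I_n -> 'cV[R]_p) (K : {set 'I_n}) : {set 'I_p} :=
  (\bigcup_(j in K) supp (tau j))%SET.

Definition cover_conditions (X : 'M[R]_p) n (tau : 'I_n -> 'cV[R]_p)
    m (Js : 'I_m -> {set 'I_n}) : Prop :=
  [/\ (0 < m)%N,
      (\bigcup_s Js s)%SET = [set: 'I_n]%SET,
      forall s i, i \in Js s -> Pstar tau (Js s) \subset Mset X (tau i) &
      (2 <= m)%N -> forall s s', s != s' ->
        [/\ (Js s :\: Js s')%SET != finset.set0,
            (Js s' :\: Js s)%SET != finset.set0 &
            forall i0, i0 \in (Js s :\: Js s')%SET ->
              exists j0 k0, [/\ j0 \in (Js s' :\: Js s)%SET,
                k0 \in supp (tau i0) & k0 \notin Mset X (tau j0)]]].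

Definition max_cover (X : 'M[R]_p) n (tau : 'I_n -> 'cV[R]_p)
    m (Js : 'I_m -> {set 'I_n}) : Prop :=
  cover_conditions X tau Js /\
  forall m' (Js' : 'I_m' -> {set 'I_n}),
    cover_conditions X tau Js' -> (m' <= m)%N.

Definition zeros_part n (tau : 'I_n -> 'cV[R]_p) (K : {set 'I_n}) :
  set 'cV[R]_p := conv_hull (tau @` [set` K])%classic.

Definition Fcone n (tau : 'I_n -> 'cV[R]_p) (K : {set 'I_n}) : set 'M[R]_p :=
  conic_hull (@sqcol R p @` zeros_part tau K)%classic.

Definition Vpairs n (K : {set 'I_n}) : {set 'I_n * 'I_n} :=
  [set ij | [&& ij.1 \in K, ij.2 \in K & (ij.1 <= ij.2)%N]]%SET.

Definition basis_of_span n (tau : 'I_n -> 'cV[R]_p) (K B : {set 'I_n}) : Prop :=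
  B \subset K /\
  basis_of <<[seq tau j | j in K]>>%VS [seq tau j | j in B].

Definition assumption_jj n (tau : 'I_n -> 'cV[R]_p)
    m (Jb : 'I_m -> {set 'I_n}) : Prop :=
  free [seq sqcol (tau x.2.1 + tau x.2.2)
       | x : 'I_m * ('I_n * 'I_n) in [set x | x.2 \in Vpairs (Jb x.1)]%SET].

Definition psubmx (X : 'M[R]_p) (P : {set 'I_p}) : 'M[R]_#|P| :=
  mxsub (enum_val (A := P)) (enum_val (A := P)) X.

End CopositiveZeros.

(* Stacked vectors are row vectors, so that the library Jacobian 'J, which acts
   on rows, is the transpose of the usual matrix of partial derivatives. *)
Section OmegaMap.
Variables (R : realType) (p m : nat) (P : 'I_m -> {set 'I_p}).

Definition dimOmega : nat := (\sum_(s < m) triang #|P s|)%N.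

Definition zvec (X : 'M[R]_p) (W : forall s : 'I_m, 'M[R]_#|P s|) :
    'rV[R]_(triang p + dimOmega) :=
  row_mx (svec X) (\mxrow_(s < m) svec (W s)).

(* Components X and W(s) of z, see zvecKX and zvecKW. *)
Definition zX (z : 'rV[R]_(triang p + dimOmega)) : 'M[R]_p :=
  smat (lsubmx z).

Definition zW (z : 'rV[R]_(triang p + dimOmega)) (s : 'I_m) : 'M[R]_#|P s| :=
  smat (submxrow (rsubmx z : 'rV[R]_(\sum_(s < m) triang #|P s|)%N) s).

Definition Omega_s (z : 'rV[R]_(triang p + dimOmega)) (s : 'I_m) :
    'rV[R]_(triang #|P s|) :=
  svec (psubmx (zX z) (P s) *m zW z s + zW z s *m psubmx (zX z) (P s)).

Definition Omega (z : 'rV[R]_(triang p + dimOmega)) : 'rV[R]_dimOmega :=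
  \mxrow_(s < m) Omega_s z s.

Lemma zvecKX X W : X \is symmetricmx -> zX (zvec X W) = X.
Proof. by move=> Xsym; rewrite /zX row_mxKl svecK. Qed.

Lemma zvecKW X W s : W s \is symmetricmx -> zW (zvec X W) s = W s.
Proof. by move=> Wsym; rewrite /zW row_mxKr mxrowK svecK. Qed.

End OmegaMap.

(* Main.v *)
(* Full rank of the Jacobian means that a vector (Y(s)), made of symmetric
   blocks, which is orthogonal to the range of the differential
   (dX, dW) |-> A(dX,s) W(s) + W(s) A(dX,s) + A(X0,s) dW(s) + dW(s) A(X0,s)
   is zero. Testing on dW gives A(X0,s) Y(s) + Y(s) A(X0,s) = 0, hence
   A(X0,s) Y(s) = 0 as A(X0,s) is positive semidefinite; testing on dX gives
   that the matrices Z(s) = W(s) Y(s) + Y(s) W(s), padded with zeros to size p,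
   sum to 0. By strict complementarity, and because A(X0,s) W(s) = 0, the range
   of Y(s) lies in that of W(s), and Z(s) = W(s) S(s) W(s) with S(s) symmetric.
   As U0(s) is a combination of squares t t^T with t in the span of the tau(j),
   polarization puts the padded Z(s) in the span of the matrices
   (tau(i) + tau(j)) (tau(i) + tau(j))^T, so jj) forces Z(s) = 0. Then
   W(s) Y(s) = 0 too, and (A(X0,s) + W(s)) Y(s) = 0 yields Y(s) = 0. *)

Require Import Defs.
From HB Require Import structures.
From mathcomp Require Import all_boot all_order all_algebra.
From mathcomp Require Import all_classical all_reals all_analysis.
From mathcomp Require Import ring lra.

Import Order.TTheory GRing.Theory Num.Theory.
Import numFieldNormedType.Exports.

Local Open Scope ring_scope.

(** * Differentiation of quadratic maps on row vectors *)

Lemma bilinear_rV_continuous (R : realType) (n m l : nat)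
    (f : {bilinear 'rV[R]_n -> 'rV[R]_m -> 'rV[R]_l}) :
  continuous (fun q : 'rV[R]_n * 'rV[R]_m => f q.1 q.2).
Proof.
(* Expanded on the standard bases, [f] is a finite sum of products of two coordinates with fixed
   vectors. *)
have -> : (fun q : 'rV[R]_n * 'rV[R]_m => f q.1 q.2) =
    (fun q => \sum_i \sum_j
      (q.1 0 i * q.2 0 j) *: f (delta_mx 0 i) (delta_mx 0 j)).
  apply/funext => -[x y] /=.
  rewrite {1}(row_sum_delta x) linear_sumlz /=; apply: eq_bigr => i _.
  rewrite {1}(row_sum_delta y) linear_sumr /=; apply: eq_bigr => j _.
  by rewrite linearZl_LR linearZr_LR scalerA.
apply: continuous_big => [|i _]; first exact: add_continuous.
apply: continuous_big => [|j _ q]; first exact: add_continuous.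
have c1 : {for q, continuous (fun q : 'rV[R]_n * 'rV[R]_m => q.1 0 i)}.
  by apply: (@continuous_comp _ _ _ fst (fun x : 'rV[R]_n => x 0 i));
    [exact: cvg_fst|exact: coord_continuous].
have c2 : {for q, continuous (fun q : 'rV[R]_n * 'rV[R]_m => q.2 0 j)}.
  by apply: (@continuous_comp _ _ _ snd (fun x : 'rV[R]_m => x 0 j));
    [exact: cvg_snd|exact: coord_continuous].
by apply: cvgZr_tmp; exact: cvgM c1 c2.
Qed.

(** Chain rule for the diagonal [x |-> (x, x)] followed by the bilinear map. *)
Lemma is_diff_quadratic (R : realType) (n l : nat)
    (f : {bilinear 'rV[R]_n -> 'rV[R]_n -> 'rV[R]_l}) (z : 'rV[R]_n) :
  is_diff z (fun x => f x x) (fun h => f z h + f h z).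
Proof.
have fc := @bilinear_rV_continuous R n n l f.
have df : is_diff (z, z) (fun q : 'rV[R]_n * 'rV[R]_n => f q.1 q.2)
    (fun q => f z q.2 + f q.1 z).
  by apply: DiffDef; [exact: differentiable_bilin|rewrite diff_bilin].
have dp : is_diff z (fun x : 'rV[R]_n => (x, x)) (fun h => (h, h)).
  exact: is_diff_pair.
exact: (is_diff_comp dp df).
Qed.

(** * The Jacobian of [Omega] through its polar form *)

Lemma smatP (R : realType) q a (u v : 'rV[R]_(triang q)) :
  smat (a *: u + v) = a *: smat u + smat v.
Proof.
apply/matrixP => i j; rewrite !mxE mulr_sumr -big_split /=.
by apply: eq_bigr => k _; rewrite !mxE mulrDl mulrA.
Qed.

Lemma svecP (R : realType) q a (F G : 'M[R]_q) :
  svec (a *: F + G) = a *: svec F + svec G.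
Proof.
by apply/rowP => k; rewrite !mxE /= !mxE; ring.
Qed.

Section OmegaDifferential.
Variables (R : realType) (p m : nat) (P : 'I_m -> {set 'I_p}).
Implicit Types z h : 'rV[R]_(triang p + dimOmega P).

(* [Omega z] is definitionally [Omega_pol z z]. *)
Definition Omega_pol z h : 'rV[R]_(dimOmega P) :=
  \mxrow_(s < m) svec (psubmx (zX z) (P s) *m zW h s
                       + zW h s *m psubmx (zX z) (P s)).

Lemma zXP a z h : zX (a *: z + h) = a *: zX z + zX h :> 'M[R]_p.
Proof. by rewrite /zX linearP smatP. Qed.

Lemma zWP a z h s : zW (a *: z + h) s = a *: zW z s + zW h s.
Proof.
rewrite /zW -smatP; congr smat; apply/rowP => k.
by rewrite /submxrow !mxE.
Qed.

Lemma psubmxP a (X Y : 'M[R]_p) (Q : {set 'I_p}) :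
  psubmx (a *: X + Y) Q = a *: psubmx X Q + psubmx Y Q.
Proof. by apply/matrixP => i j; rewrite !mxE. Qed.

Lemma Omega_pol_bilinear :
  bilinear_for (GRing.Scale.Law.clone _ _ *:%R _)
    (GRing.Scale.Law.clone _ _ *:%R _) Omega_pol.
Proof.
have mxrowP' a (F G : forall s, 'rV[R]_(triang #|P s|)) :
    \mxrow_s (a *: F s + G s) = a *: \mxrow_s F s + \mxrow_s G s.
  by apply/rowP => k; rewrite !mxE.
split=> [h|z] a u v; rewrite /Omega_pol /= -mxrowP'; apply/eq_mxrow => s;
    rewrite -svecP; congr svec.
  rewrite zXP psubmxP mulmxDl mulmxDr.
  by rewrite -scalemxAl -scalemxAr scalerDr [RHS]addrACA.
by rewrite zWP mulmxDl mulmxDr -scalemxAl -scalemxAr scalerDr [RHS]addrACA.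
Qed.

HB.instance Definition _ := bilinear_isBilinear.Build _ _ _ _ _ _ Omega_pol
  Omega_pol_bilinear.

(** [Omega] is the diagonal of the bilinear [Omega_pol], and multiplying a row by ['J] applies the
    differential to it. *)
Lemma mul_jacobian_Omega z h :
  h *m 'J (Omega (P := P)) z = Omega_pol z h + Omega_pol h z.
Proof.
have dO : is_diff z (Omega (P := P)) (fun h => Omega_pol z h + Omega_pol h z).
  exact: (is_diff_quadratic _ _ _ (Omega_pol : {bilinear _ -> _ -> _}) z).
by rewrite /jacobian mul_rV_lin1 diff_val.
Qed.

End OmegaDifferential.

(** * Positive semidefinite matrices and the equation [A Y + Y A = 0] *)

Section PositiveSemidefinite.
Variables (R : realType) (q : nat).
Implicit Types A W Y : 'M[R]_q.

Lemma trmx_sym A : A \is symmetricmx -> A^T = A.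
Proof. by rewrite symmetricmxE => /eqP. Qed.

Lemma mul_trmx_diag_ge0 m (B : 'M[R]_(m, q)) i : 0 <= (B *m B^T) i i.
Proof.
by rewrite mxE; apply: sumr_ge0 => k _; rewrite mxE -expr2 sqr_ge0.
Qed.

Lemma mxtrace_mul_tr_eq0 m (B : 'M[R]_(m, q)) : \tr (B *m B^T) = 0 -> B = 0.
Proof.
move=> /eqP; rewrite psumr_eq0 => [|i _]; last exact: mul_trmx_diag_ge0.
move=> /allP B0; apply/matrixP => i k; rewrite mxE.
have := B0 i (mem_index_enum i); rewrite /= mxE psumr_eq0 => [|l _]; last first.
  by rewrite mxE -expr2 sqr_ge0.
move=> /allP /(_ k (mem_index_enum k)) /=.
by rewrite mxE -expr2 sqrf_eq0 => /eqP.
Qed.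

Lemma qformD A (x y : 'cV[R]_q) : A \is symmetricmx ->
  qform A (x + y) = qform A x + (y^T *m A *m x) 0 0 *+ 2 + qform A y.
Proof.
move=> /trmx_sym As.
have mxD (B C : 'M[R]_1) : (B + C) 0 0 = B 0 0 + C 0 0 by rewrite mxE.
rewrite /qform [(x + y)^T]linearD /= mulmxDl mulmxDr !mulmxDl !mxD.
have -> : (x^T *m A *m y) 0 0 = (y^T *m A *m x) 0 0.
  transitivity ((x^T *m A *m y)^T 0 0); first by rewrite [RHS]mxE.
  by rewrite !trmx_mul trmxK As mulmxA.
by rewrite mulr2n; ring.
Qed.

Lemma qformZ A a (x : 'cV[R]_q) : qform A (a *: x) = a ^+ 2 * qform A x.
Proof.
rewrite /qform [(a *: x)^T]linearZ /= -!scalemxAl -scalemxAr !mxE.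
by rewrite expr2 mulrA.
Qed.

(* The form at [t - s A t] is [-2 s |A t|^2 + O(s^2)], which is nonnegative for
   all [s] only if [A t = 0]. *)
Lemma psdmx_qform_eq0 A (t : 'cV[R]_q) : psdmx A -> qform A t = 0 -> A *m t = 0.
Proof.
move=> [As A0] At0; set x := A *m t.
set b := (x^T *m A *m t) 0 0.
have b0 : 0 <= b.
  by rewrite /b -mulmxA -/x -[X in _ *m X]trmxK mul_trmx_diag_ge0.
have xb : b = 0 -> x = 0.
  rewrite /b -mulmxA -/x => bE; apply: trmx_inj; rewrite trmx0.
  apply: mxtrace_mul_tr_eq0; rewrite trmxK.
  by rewrite /mxtrace big_ord1.
apply: xb; set c := qform A x.
have c0 : 0 <= c by exact: A0.
(* Here [b] is [|A t|^2]. The step [s = b / (c + 1)] gives the value [s^2 (c - 2 (c + 1))], negative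
   when [b > 0]; the added 1 keeps the denominator positive when [c = 0]. *)
have := A0 (t + (- (b / (c + 1))) *: x).
rewrite qformD // At0 add0r qformZ -/c.
rewrite [(_ *: x)^T]linearZ /= -!scalemxAl mxE -/b.
have c1 : 0 < c + 1 by rewrite ltr_wpDl.
move=> H; apply/eqP; rewrite eq_le b0 andbT leNgt; apply/negP => bgt0.
have : 0 <= (b / (c + 1)) ^+ 2 * (- (c + 1) *+ 2 + c).
  apply: le_trans H _; rewrite le_eqVlt; apply/orP; left; apply/eqP.
  by field; rewrite gt_eqF.
rewrite pmulr_rge0 ?exprn_gt0 ?divr_gt0 // leNgt => /negP; apply.
by rewrite mulr2n; lra.
Qed.

(** Since [Y A = - A Y], cyclicity makes the trace of [Y A Y] its own opposite, hence 0. Its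
    diagonal entries are the nonnegative values of the form of [A] at the columns of [Y], so all of
    them vanish and [A] kills every column. *)
Lemma psdmx_anticommute A Y : psdmx A -> Y \is symmetricmx ->
  A *m Y + Y *m A = 0 -> A *m Y = 0.
Proof.
move=> pA /trmx_sym Ys AY; have [As A0] := pA.
have YAY i : (Y *m A *m Y) i i = qform A (col i Y).
  rewrite /qform tr_col Ys -row_mul [LHS]mxE [RHS]mxE.
  by apply: eq_bigr => k _; rewrite !mxE.
have tr0 : \tr (Y *m A *m Y) = 0.
  have E : Y *m A = - (A *m Y) by apply/eqP; rewrite -addr_eq0 addrC AY.
  have : \tr (Y *m A *m Y) = - \tr (Y *m A *m Y).
    by rewrite {1}E mulNmx linearN /= mxtrace_mulC mulmxA.
  by move=> H; lra.
apply/matrixP => a i; rewrite -[LHS]/((A *m Y) a i) [RHS]mxE.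
have /psdmx_qform_eq0 : qform A (col i Y) = 0.
  move/eqP: tr0; rewrite psumr_eq0 => [|j _]; last by rewrite YAY A0.
  by move=> /allP /(_ i (mem_index_enum i)) /eqP; rewrite YAY.
move=> /(_ pA) /colP /(_ a); rewrite !mxE => H.
by rewrite -[RHS]H; apply: eq_bigr => k _; rewrite mxE.
Qed.

Lemma posdefmx_unit A : posdefmx A -> A \in unitmx.
Proof.
move=> [As A0]; rewrite -row_free_unit; apply: inj_row_free => v vA.
apply/eqP/negPn/negP => v0.
have := A0 v^T; rewrite trmx_eq0 v0 /qform trmxK vA mul0mx mxE ltxx.
by move=> /(_ isT).
Qed.

(* With [G = (A + W)^-1], [Y] is [W G Y = Y G W], so
   [W Y + Y W = W (Y G + G Y) W]. *)
Lemma sylvester_factor A W Y : A \is symmetricmx -> W \is symmetricmx ->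
    Y \is symmetricmx -> A + W \in unitmx -> A *m W = 0 -> A *m Y = 0 ->
  exists2 S, S \is symmetricmx & W *m Y + Y *m W = W *m S *m W.
Proof.
move=> /trmx_sym As /trmx_sym Ws /trmx_sym Ys AWu AW AY.
set G := invmx (A + W).
have Gs : G^T = G by rewrite trmx_inv linearD /= As Ws.
have WA : W *m A = 0 by rewrite -[LHS]trmxK trmx_mul As Ws AW trmx0.
(* [A] commutes with [A + W] because [A W = W A = 0], hence also with the inverse [G]. *)
have AGA : A *m G = G *m A.
  rewrite -[LHS](mulKmx AWu) -/G; congr (_ *m _).
  by rewrite mulmxA mulmxDl WA addr0 -[RHS](mulmxK AWu) mulmxDr AW addr0.
have YE : Y = W *m G *m Y.
  have AGY : A *m (G *m Y) = 0 by rewrite mulmxA AGA -mulmxA AY mulmx0.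
  by rewrite -[LHS](mulKVmx AWu) -/G mulmxDl AGY add0r mulmxA.
have YE' : Y = Y *m G *m W.
  by rewrite -[LHS]Ys [in LHS]YE !trmx_mul Ys Gs Ws mulmxA.
exists (Y *m G + G *m Y).
  by rewrite symmetricmxE linearD /= !trmx_mul Ys Gs addrC.
rewrite mulmxDr mulmxDl; congr (_ + _).
  by rewrite -!mulmxA [Y *m _]mulmxA -YE'.
by rewrite [W *m _]mulmxA -YE.
Qed.

End PositiveSemidefinite.

(** The weight [sqrt 2] squares to 2, which counts an off-diagonal entry together with its mirror
    image. Orthogonality of stacked vectors can thus be read on traces. *)
Lemma svec_dot (R : realType) q (F G : 'M[R]_q) :
  F \is symmetricmx -> G \is symmetricmx ->
  svec F *m (svec G)^T = (\tr (F *m G))%:M.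
Proof.
move=> /trmx_sym Fs /trmx_sym Gs.
pose h (ij : 'I_q * 'I_q) := F ij.1 ij.2 * G ij.1 ij.2.
have hC i j : h (i, j) = h (j, i).
  by rewrite /h /= -{1}Fs -{1}Gs !mxE.
rewrite [LHS]mx11_scalar; congr (_%:M).
transitivity (\sum_(ij : 'I_q * 'I_q | (ij.2 <= ij.1)%N)
                svec_weight R ij ^+ 2 * h ij).
  rewrite mxE.
  transitivity (\sum_(ij <- lower_tuple q) svec_weight R ij ^+ 2 * h ij).
    rewrite big_tuple; apply: eq_bigr => k _; rewrite !mxE /= /h expr2.
    by ring.
  rewrite [RHS]big_mkcond -big_mkcond -big_filter; apply: perm_big.
  apply: uniq_perm => [||[i j]]; first exact: uniq_lower_pairs.
    exact/filter_uniq/index_enum_uniq.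
  by rewrite mem_lower_tuple mem_filter mem_index_enum andbT.
transitivity (\sum_(ij : 'I_q * 'I_q) h ij); last first.
  transitivity (\sum_(ij : 'I_q * 'I_q) h (ij.1, ij.2)).
    by apply: eq_bigr => -[].
  rewrite -(pair_big predT predT (fun i j => h (i, j))) /=.
  rewrite /mxtrace; apply: eq_bigr => i _; rewrite mxE; apply: eq_bigr => j _.
  by rewrite /h /= -{2}Gs mxE.
rewrite [RHS](bigID (fun ij : 'I_q * 'I_q => (ij.2 <= ij.1)%N)) /=.
rewrite (bigID (fun ij : 'I_q * 'I_q => ij.1 == ij.2)) /=.
rewrite [X in _ = X + _](bigID (fun ij : 'I_q * 'I_q => ij.1 == ij.2)) /=.
rewrite -addrA; congr (_ + _).
  apply: eq_bigr => -[i j] /= /andP[_ ij].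
  by rewrite /svec_weight /= ij expr1n mul1r.
(* Swapping the indices sends the strict upper triangle to the strict lower one and preserves
   [h]. *)
have -> : \sum_(ij : 'I_q * 'I_q | ~~ (ij.2 <= ij.1)%N) h ij =
    \sum_(ij : 'I_q * 'I_q | (ij.2 <= ij.1)%N && (ij.1 != ij.2)) h ij.
  rewrite (reindex_inj (h := fun ij => (ij.2, ij.1))) /=; last first.
    by move=> [i j] [i' j'] /= [-> ->].
  apply: eq_big => [[i j]|[i j] _] /=; last exact: hC.
  by rewrite -ltnNge ltn_neqAle andbC eq_sym.
rewrite -big_split /=; apply: eq_bigr => -[i j] /= /andP[_ ij].
rewrite /svec_weight /= (negbTE ij) sqr_sqrtr ?ler0n //.
by ring.
Qed.

(** * Coefficients in spans and free families *)

Section Spans.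
Variables (R : realType) (vT : vectType R).

Lemma memv_span_image (I : finType) (K : {set I}) (F : I -> vT) x :
  x \in <<[seq F j | j in K]>>%VS ->
  exists a : I -> R, x = \sum_(j in K) a j *: F j.
Proof.
rewrite span_def big_map big_enum => /memv_sumP [v vF ->].
have /choice[a aE] : forall j, exists a, j \in K -> v j = a *: F j.
  move=> j; case: (boolP (j \in K)) => [jK|_]; last by exists 0.
  by have /vlineP[a ->] := vF j jK; exists a.
by exists a; apply: eq_bigr => j jK; exact: aE.
Qed.

Lemma free_image_coef0 (I : finType) (K : {set I}) (F : I -> vT) (c : I -> R) :
  free [seq F j | j in K] -> \sum_(j in K) c j *: F j = 0 ->
  forall j, j \in K -> c j = 0.
Proof.
move=> fr sum0 j jK; have /freeP indep : free (image_tuple F (mem K)) := fr.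
have := indep (fun i => c (enum_val i)).
rewrite -(enum_rankK_in jK jK) => -> //.
rewrite -[RHS]sum0 [RHS]big_enum_val; apply: eq_bigr => i _.
by rewrite nth_image.
Qed.

(** A subspace is convex, so it contains the smallest convex set around [A]. *)
Lemma conv_hull_sub_vspace (A : set vT) (V : {vspace vT}) x :
  (forall y, A y -> y \in V) -> conv_hull A x -> x \in V.
Proof.
move=> AV; apply: (smallest_sub (X := [set y | y \in V]%classic)) => //.
move=> y z l; rewrite !inE => yV zV.
by apply: memvD; apply: memvZ.
Qed.

End Spans.

(** * Polarization of squares of the vertices *)

Section SymmetricProducts.
Variables (R : realType) (p n : nat) (tau : 'I_n -> 'cV[R]_p) (K : {set 'I_n}).

Let V := <<[seq sqcol (tau ij.1 + tau ij.2) | ij : 'I_n * 'I_n in Vpairs K]>>%VS.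

(* Polarization; [tau i + tau i] contributes [4 (tau i) (tau i)^T]. *)
Lemma polar_tau i j : i \in K -> j \in K ->
  tau i *m (tau j)^T + tau j *m (tau i)^T \in V.
Proof.
have memV a b : a \in K -> b \in K -> (a <= b)%N -> sqcol (tau a + tau b) \in V.
  move=> aK bK ab; apply: memv_span; apply/mapP; exists (a, b) => //.
  by rewrite mem_enum inE /= aK bK.
have sqD (x y : 'cV[R]_p) :
    sqcol (x + y) = sqcol x + sqcol y + (x *m y^T + y *m x^T).
  rewrite /sqcol [(x + y)^T]linearD /= mulmxDl !mulmxDr -!addrA; congr (_ + _).
  by rewrite [RHS]addrC addrA.
have sqV a : a \in K -> sqcol (tau a) \in V.
  move=> aK; have := memV a a aK aK (leqnn _).
  rewrite sqD -/(sqcol (tau a)) addrACA -!mulr2n -mulrnA -scaler_nat.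
  by rewrite rpredZeq pnatr_eq0.
(* [Vpairs] holds only ordered pairs, while the polar product is symmetric in [i] and [j]. *)
wlog ij : i j / (i <= j)%N => [wl|] iK jK.
  by case: (leqP i j) => [/wl ->//|/ltnW /wl wji]; rewrite addrC wji.
have -> : tau i *m (tau j)^T + tau j *m (tau i)^T =
    sqcol (tau i + tau j) - (sqcol (tau i) + sqcol (tau j)).
  by rewrite sqD addrAC subrr add0r.
by rewrite memvB ?memvD ?sqV ?memV.
Qed.

Lemma polar_span x y :
  x \in <<[seq tau j | j in K]>>%VS -> y \in <<[seq tau j | j in K]>>%VS ->
  x *m y^T + y *m x^T \in V.
Proof.
move=> /memv_span_image[a ->] /memv_span_image[b ->].
have -> : (\sum_(j in K) a j *: tau j) *m (\sum_(j in K) b j *: tau j)^T +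
          (\sum_(j in K) b j *: tau j) *m (\sum_(j in K) a j *: tau j)^T =
    \sum_(i in K) \sum_(j in K)
      (a i * b j) *: (tau i *m (tau j)^T + tau j *m (tau i)^T).
  rewrite ![(\sum_(j in K) _)^T]raddf_sum /= mulmx_suml mulmx_sumr.
  rewrite -big_split /=.
  apply: eq_bigr => i iK; rewrite mulmx_sumr mulmx_suml -big_split /=.
  apply: eq_bigr => j jK; rewrite ![(_ *: _)^T]linearZ /=.
  rewrite -!scalemxAl -!scalemxAr !scalerA.
  by rewrite scalerDr [b j * _]mulrC.
by apply: memv_suml => i iK; apply: memv_suml => j jK; rewrite memvZ ?polar_tau.
Qed.

(** With [U] a combination of squares of vectors [t i], the product [U S U] is a combination of the
    [t i (t j)^T]. It is symmetric, so its double, the sum with its transpose, involves only polar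
    products, which [polar_span] handles. *)
Lemma conic_hull_sandwich (A : set 'cV[R]_p) (U S : 'M[R]_p) :
  (forall t, A t -> t \in <<[seq tau j | j in K]>>%VS) ->
  conic_hull (@sqcol R p @` A)%classic U -> S \is symmetricmx ->
  U *m S *m U \in V.
Proof.
move=> AK [k [c [M [c0 MA ->]]]] /trmx_sym Ss.
have /choice[t tE] : forall i, exists t, A t /\ sqcol t = M i.
  by move=> i; have [t At tM] := MA i; exists t.
set U' := \sum_i _.
have U's : U'^T = U'.
  rewrite /U' raddf_sum; apply: eq_bigr => i _; rewrite /= linearZ /=.
  by rewrite -(tE i).2 /sqcol trmx_mul trmxK.
have UE : U' = \sum_i c i *: sqcol (t i).
  by apply: eq_bigr => i _; rewrite (tE i).2.
pose g i j := c i * c j * ((t i)^T *m S *m t j) 0 0.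
have USU : U' *m S *m U' = \sum_i \sum_j g i j *: (t i *m (t j)^T).
  rewrite UE !mulmx_suml; apply: eq_bigr => i _.
  rewrite mulmx_sumr; apply: eq_bigr => j _.
  rewrite -!scalemxAl -scalemxAr scalerA /g -[RHS]scalerA; congr (_ *: _).
  have -> : sqcol (t i) *m S *m sqcol (t j) =
      t i *m ((t i)^T *m S *m t j) *m (t j)^T by rewrite /sqcol !mulmxA.
  by rewrite {1}[_ *m S *m t j]mx11_scalar mul_mx_scalar -scalemxAl.
have USUs : (U' *m S *m U')^T = U' *m S *m U'.
  by rewrite !trmx_mul U's Ss mulmxA.
suff : U' *m S *m U' + (U' *m S *m U')^T \in V.
  by rewrite USUs -mulr2n -scaler_nat rpredZeq pnatr_eq0.
rewrite USU raddf_sum -big_split /=; apply: memv_suml => i _.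
rewrite raddf_sum -big_split /=; apply: memv_suml => j _.
rewrite linearZ /= -scalerDr trmx_mul trmxK.
by apply: memvZ; apply: polar_span; apply: AK; exact: (tE _).1.
Qed.

End SymmetricProducts.

(** * Restriction to an index set and padding by zeros *)

Section Selection.
Variables (R : realType) (p : nat) (P : {set 'I_p}).

(** The columns are the [e_k] with [k] in [P]: multiplying by [selmx] pads with zeros, multiplying
    by its transpose restricts to [P]. *)
Definition selmx : 'M[R]_(p, #|P|) := colsub (enum_val (A := P)) 1%:M.

Lemma psubmxE (X : 'M[R]_p) : psubmx X P = selmx^T *m X *m selmx.
Proof.
have -> : selmx^T = rowsub (enum_val (A := P)) 1%:M.
  by apply/matrixP => k j; rewrite !mxE eq_sym.
by rewrite mul_rowsub_mx mul1mx mulmx_colsub mulmx1 -mxsubcr.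
Qed.

Lemma tr_selmxK : selmx^T *m selmx = 1%:M.
Proof.
have := psubmxE 1%:M; rewrite mulmx1 => <-.
by apply/matrixP => i j; rewrite !mxE (inj_eq enum_val_inj).
Qed.

Lemma selmx_supp (t : 'cV[R]_p) : supp t \subset P ->
  selmx *m (selmx^T *m t) = t.
Proof.
move=> tP; apply/colP => i; rewrite mxE.
transitivity (\sum_(j in P) (i == j)%:R * t j 0).
  rewrite [RHS]big_enum_val; apply: eq_bigr => k _; rewrite !mxE; congr (_ * _).
  rewrite (bigD1 (enum_val k)) //= big1 ?addr0 => [|j jk].
    by rewrite !mxE eqxx mul1r.
  by rewrite !mxE (negbTE jk) mul0r.
case: (boolP (i \in P)) => iP.
  rewrite (bigD1 i) //= eqxx mul1r big1 ?addr0 // => j /andP[_ ji].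
  by rewrite eq_sym (negbTE ji) mul0r.
rewrite big1 => [|j jP]; last first.
  by case: eqP => [E|]; rewrite ?mul0r//; move: iP; rewrite E jP.
apply/esym/eqP; apply: contraNT iP => ti.
by have := fintype.subsetP tP i; rewrite inE; apply.
Qed.

Lemma selmx_zero (X : 'M[R]_p) t : P \subset Mset X t ->
  selmx^T *m (X *m t) = 0.
Proof.
move=> /fintype.subsetP PM; apply/colP => k.
rewrite !mxE (bigD1 (enum_val k)) //=.
have := PM _ (enum_valP k); rewrite inE => /eqP ->; rewrite mulr0 add0r.
by rewrite big1 // => j jk; rewrite !mxE (negbTE jk) mul0r.
Qed.

End Selection.

(** * The left kernel of the transposed Jacobian *)

Section Blocks.
Variables (R : realType) (p m : nat) (P : 'I_m -> {set 'I_p}).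

Lemma Omega_pol_zvec X W X' W' :
    X \is symmetricmx -> (forall s, W s \is symmetricmx) ->
    X' \is symmetricmx -> (forall s, W' s \is symmetricmx) ->
  @Omega_pol R p m P (zvec X W) (zvec X' W') =
    \mxrow_s svec (psubmx X (P s) *m W' s + W' s *m psubmx X (P s)).
Proof.
move=> Xs Ws X's W's; apply: eq_mxrow => s.
by rewrite zvecKX // zvecKW.
Qed.

Lemma mxrow_svec_dot (Y Z : forall s : 'I_m, 'M[R]_#|P s|) :
    (forall s, Y s \is symmetricmx) -> (forall s, Z s \is symmetricmx) ->
  (\mxrow_s svec (Y s)) *m (\mxrow_s svec (Z s))^T =
    (\sum_s \tr (Y s *m Z s))%:M.
Proof.
move=> Ys Zs; rewrite tr_mxrow mul_mxrow_mxcol raddf_sum /=.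
by apply: eq_bigr => s _; rewrite svec_dot.
Qed.

(* Test directions: [dW s = A s Y s + Y s A s], then [dX] equal to the sum that
   is to vanish; each turns orthogonality into a vanishing Frobenius norm. *)
Lemma kernel_jacobian_Omega X W (u : 'rV[R]_(dimOmega P)) :
    X \is symmetricmx -> (forall s, W s \is symmetricmx) ->
    u *m ('J (Omega (P := P)) (zvec X W))^T = 0 ->
  let Y s := smat (submxrow (u : 'rV[R]_(\sum_(s < m) triang #|P s|)%N) s) in
  let A s := psubmx X (P s) in
  (forall s, A s *m Y s + Y s *m A s = 0) /\
  (\sum_s selmx R p (P s) *m (W s *m Y s + Y s *m W s) *m (selmx R p (P s))^T
     = 0).
Proof.
move=> Xs Ws uJ Y A.
have Ys s : Y s \is symmetricmx by exact: smat_sym.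
have uE : u = \mxrow_s svec (Y s).
  rewrite -[LHS](@submxrowK _ _ (fun s => triang #|P s|)).
  by apply: eq_mxrow => s; rewrite smatK.
have psub_sym X' s : X' \is symmetricmx -> psubmx X' (P s) \is symmetricmx.
  move=> /trmx_sym X's; rewrite symmetricmxE; apply/eqP/matrixP => i j.
  by rewrite !mxE -[in LHS]X's mxE.
have anticomm_sym q (B C : 'M[R]_q) : B \is symmetricmx -> C \is symmetricmx ->
    B *m C + C *m B \is symmetricmx.
  move=> /trmx_sym Bs /trmx_sym Cs.
  by rewrite symmetricmxE linearD /= !trmx_mul Bs Cs addrC.
(* Orthogonality of [u] to the image of the direction [(X', W')], written with traces. *)
have test X' W' : X' \is symmetricmx -> (forall s, W' s \is symmetricmx) ->
    \sum_s \tr (Y s *m (A s *m W' s + W' s *m A s)) +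
    \sum_s \tr (Y s *m (psubmx X' (P s) *m W s + W s *m psubmx X' (P s))) = 0.
  move=> X's W's.
  have : u *m (zvec X' W' *m 'J (Omega (P := P)) (zvec X W))^T = 0.
    by rewrite trmx_mul mulmxA uJ mul0mx.
  rewrite mul_jacobian_Omega !Omega_pol_zvec // linearD /= mulmxDr uE.
  rewrite !mxrow_svec_dot // => [|s|s].
  - by rewrite -raddfD /= => /matrixP /(_ 0 0); rewrite !mxE eqxx mulr1n.
  - by apply: anticomm_sym => //; exact: psub_sym.
  - by apply: anticomm_sym => //; exact: psub_sym.
have As s : A s \is symmetricmx by exact: psub_sym.
have zero_sym q : (0 : 'M[R]_q) \is symmetricmx.
  by rewrite symmetricmxE trmx0.
split.
  have := test 0 (fun s => A s *m Y s + Y s *m A s) (zero_sym _)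
    (fun s => anticomm_sym _ _ _ (As s) (Ys s)).
  rewrite [X in _ + X]big1 => [|s _]; last first.
    have -> : psubmx (0 : 'M[R]_p) (P s) = 0.
      by apply/matrixP => i j; rewrite !mxE.
    by rewrite mul0mx mulmx0 addr0 mulmx0 mxtrace0.
  rewrite addr0.
  (* With [N = A Y + Y A] symmetric, moving [A] around the trace turns [tr (Y (A N + N A))] into
     [tr (N N)]. *)
  have trE s : \tr (Y s *m (A s *m (A s *m Y s + Y s *m A s)
                            + (A s *m Y s + Y s *m A s) *m A s))
      = \tr ((A s *m Y s + Y s *m A s) *m (A s *m Y s + Y s *m A s)^T).
    set N := A s *m Y s + Y s *m A s.
    have -> : N^T = N by apply: trmx_sym; exact: anticomm_sym.
    have -> : N *m N = A s *m (Y s *m N) + Y s *m (A s *m N).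
      by rewrite {1}/N mulmxDl !mulmxA.
    clearbody N; rewrite mulmxDr.
    rewrite !mxtraceD [RHS]addrC [\tr (A s *m _)]mxtrace_mulC.
    by rewrite !mulmxA.
  move=> /eqP; rewrite psumr_eq0 => [/allP H s|s _]; last first.
    by rewrite trE; apply: sumr_ge0 => i _; exact: mul_trmx_diag_ge0.
  apply/mxtrace_mul_tr_eq0/eqP; rewrite -trE.
  exact: (H s (mem_index_enum s)).
set D := \sum_s _.
have Ds : D \is symmetricmx.
  rewrite symmetricmxE /D raddf_sum /=; apply/eqP/eq_bigr => s _.
  rewrite !trmx_mul trmxK (trmx_sym _ _ _ (anticomm_sym _ _ _ (Ws s) (Ys s))).
  by rewrite mulmxA.
have := test D (fun=> 0) Ds (fun=> zero_sym _).
rewrite big1 => [|s _]; last by rewrite mul0mx mulmx0 addr0 mulmx0 mxtrace0.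
rewrite add0r => trD; apply: mxtrace_mul_tr_eq0; rewrite (trmx_sym _ _ _ Ds).
rewrite -[RHS]trD {1}/D mulmx_suml raddf_sum /=; apply: eq_bigr => s _.
rewrite psubmxE; set E := selmx _ _ _.
set B := E^T *m D *m E.
(* Padding is adjoint to restriction for the trace product, so [D] enters only through its block
   [B]. *)
have -> : \tr (E *m (W s *m Y s + Y s *m W s) *m E^T *m D) =
    \tr ((W s *m Y s + Y s *m W s) *m B).
  by rewrite /B -!mulmxA mxtrace_mulC -!mulmxA.
clearbody B; rewrite mulmxDl mulmxDr !mxtraceD; congr (_ + _).
  by rewrite -mulmxA mxtrace_mulC -mulmxA.
by rewrite mulmxA.
Qed.

End Blocks.

(** * Full row rank of the Jacobian *)

Theorem proposition5p1 (R : realType) (p : nat) (hp : (0 < p)%N)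
    (X0 U0 : 'M[R]_p)
    (hXU : complementary_pairs (X0, U0))
    (hT : (zeros X0 !=set0)%classic)
    (nJ : nat) (tau : 'I_nJ -> 'cV[R]_p) (htau : vertex_enum X0 tau)
    (nS : nat) (Js : 'I_nS -> {set 'I_nJ}) (hJs : max_cover X0 tau Js)
    (Jb : 'I_nS -> {set 'I_nJ}) (hJb : forall s, basis_of_span tau (Js s) (Jb s))
    (U0s : 'I_nS -> 'M[R]_p)
    (hU0 : U0 = \sum_s U0s s)
    (hU0s : forall s, Fcone tau (Js s) (U0s s))
    (hjj : assumption_jj tau Jb) :
  let P s := Pstar tau (Js s) in
  (forall s, [/\ psdmx (psubmx X0 (P s)),
                 psdmx (psubmx (U0s s) (P s)) &
                 posdefmx (psubmx X0 (P s) + psubmx (U0s s) (P s))]) ->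
  let z0 := zvec X0 (fun s => psubmx (U0s s) (P s)) in
  \rank ('J (@Omega R p nS P) z0)^T = (\sum_(s < nS) triang #|P s|)%N.
Proof.
move=> P hyp z0.
have [X0s _] : COP X0 by have [] := hXU.
pose W s := psubmx (U0s s) (P s).
have Ws s : W s \is symmetricmx by have [_ []] := hyp s.
suff Jfree : row_free ('J (@Omega R p nS P) z0)^T by exact/eqP.
apply: inj_row_free => u uJ.
have := kernel_jacobian_Omega _ _ _ _ _ _ u X0s Ws uJ.
set Y := fun s => smat _; set A := fun s => psubmx X0 (P s) => -[AYYA sum0].
have Ys s : Y s \is symmetricmx by exact: smat_sym.
have AY s : A s *m Y s = 0.
  by have [pA _ _] := hyp s; exact: psdmx_anticommute (AYYA s).
pose E s := selmx R p (P s).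
have ETE s : (E s)^T *m E s = 1%:M by exact: tr_selmxK.
pose Sp s := <<[seq tau j | j in Js s]>>%VS.
(* Each [tau j] with [j] in [Js s] is supported in [P s], and condition b) makes the rows of
   [X0 *m tau j] indexed by [P s] vanish. Both properties are linear in the vector. *)
have SpP s t : t \in Sp s ->
    E s *m ((E s)^T *m t) = t /\ (E s)^T *m (X0 *m t) = 0.
  have [[_ _ cover _] _] := hJs.
  move=> /memv_span_image[a ->]; split; rewrite !mulmx_sumr.
    apply: eq_bigr => j jK; rewrite -!scalemxAr selmx_supp //.
    exact: (finset.bigcup_sup j).
  apply: big1 => j jK; rewrite -!scalemxAr selmx_zero ?scaler0 //.
  exact: cover.
have FSp s t : zeros_part tau (Js s) t -> t \in Sp s.
  apply: conv_hull_sub_vspace => _ [j jK <-].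
  by apply/memv_span/map_f; rewrite mem_enum.
(* These properties pass from the vectors [t] to the squares [t t^T] composing [U0s s]. *)
have UP s : [/\ (U0s s)^T = U0s s, E s *m ((E s)^T *m U0s s) = U0s s &
    (E s)^T *m (X0 *m U0s s) = 0].
  have [k [c [M [_ MA ->]]]] := hU0s s.
  have Mt i : exists2 t, t \in Sp s & M i = t *m t^T.
    by have [t /FSp tS <-] := MA i; exists t.
  split.
  - rewrite raddf_sum; apply: eq_bigr => i _; rewrite /= linearZ /=.
    by have [t _ ->] := Mt i; rewrite trmx_mul trmxK.
  - rewrite !mulmx_sumr; apply: eq_bigr => i _; rewrite -!scalemxAr.
    have [t /SpP[tE _] ->] := Mt i.
    by rewrite [(E s)^T *m _]mulmxA [E s *m _]mulmxA tE.
  rewrite !mulmx_sumr; apply: big1 => i _; rewrite -!scalemxAr.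
  have [t /SpP[_ tE] ->] := Mt i.
  by rewrite [X0 *m _]mulmxA [(E s)^T *m _]mulmxA tE mul0mx scaler0.
have AW s : A s *m W s = 0.
  have [_ UE XU] := UP s.
  rewrite /A /W !psubmxE -/(E s) -!mulmxA.
  have -> : E s *m ((E s)^T *m (U0s s *m E s)) = U0s s *m E s.
    by rewrite [(E s)^T *m _]mulmxA mulmxA UE.
  by rewrite [X0 *m _]mulmxA mulmxA XU mul0mx.
have EWE s : E s *m W s *m (E s)^T = U0s s.
  have [Us UE _] := UP s.
  rewrite /W psubmxE -/(E s) -!mulmxA.
  have -> : U0s s *m (E s *m (E s)^T) = U0s s.
    by have := congr1 trmx UE; rewrite !trmx_mul trmxK Us -mulmxA.
  exact: UE.
pose V s := <<[seq sqcol (tau ij.1 + tau ij.2)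
              | ij : 'I_nJ * 'I_nJ in Vpairs (Jb s)]>>%VS.
pose Z s := W s *m Y s + Y s *m W s.
have ZV s : E s *m Z s *m (E s)^T \in V s.
  have [[As _] _ /posdefmx_unit AWu] := hyp s.
  have [S Ss ZS] :=
    sylvester_factor _ _ _ _ _ As (Ws s) (Ys s) AWu (AW s) (AY s).
  (* [U0s s] is [W s] padded, and [(E s)^T *m E s = 1] cancels between the factors. *)
  have -> : E s *m Z s *m (E s)^T =
      U0s s *m (E s *m S *m (E s)^T) *m U0s s.
    rewrite -(EWE s) /Z ZS !mulmxA -(mulmxA _ (E s)^T (E s)) ETE mulmx1.
    by rewrite -(mulmxA _ (E s)^T (E s)) ETE mulmx1.
  apply: conic_hull_sandwich (hU0s s) _.
    move=> t /FSp; rewrite /Sp.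
    (* The span of the basis indexed by [Jb s] is that of all [tau j] with [j] in [Js s]; this
       brings in the family of jj). *)
    by have [_ /andP[/eqP -> _]] := hJb s.
  by rewrite symmetricmxE !trmx_mul trmxK (trmx_sym _ _ _ Ss) mulmxA.
have /choice[a aE] : forall s, exists a : 'I_nJ * 'I_nJ -> R,
    E s *m Z s *m (E s)^T =
    \sum_(ij in Vpairs (Jb s)) a ij *: sqcol (tau ij.1 + tau ij.2).
  by move=> s; exact: memv_span_image (ZV s).
(* Only the sum over all [s] is known to vanish; jj) is freeness of the joint family over pairs
   [(s, ij)], so it kills every coefficient of every block. *)
have a0 s ij : ij \in Vpairs (Jb s) -> a s ij = 0.
  move=> ijV.
  apply: (free_image_coef0 _ _ _ _ _ (fun x => a x.1 x.2) hjj _ (s, ij)).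
    rewrite -[RHS]sum0.
    under [RHS]eq_bigr => s' _ do rewrite -/(E s') -/(Z s') aE.
    rewrite (pair_big_dep predT (fun s ij => ij \in Vpairs (Jb s))
      (fun s ij => a s ij *: sqcol (tau ij.1 + tau ij.2))) /=.
    by apply: eq_bigl => -[s' ij']; rewrite inE.
  by rewrite inE.
have Z0 s : Z s = 0.
  have ZE : E s *m Z s *m (E s)^T = 0.
    by rewrite aE big1 // => ij ijV; rewrite a0 // scale0r.
  have : (E s)^T *m (E s *m Z s *m (E s)^T) *m E s = 0.
    by rewrite ZE mulmx0 mul0mx.
  by rewrite -!mulmxA ETE mulmx1 mulmxA ETE mul1mx.
have WY s : W s *m Y s = 0.
  by have [_ pW _] := hyp s; exact: psdmx_anticommute (Z0 s).
have Y0 s : Y s = 0.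
  have [_ _ /posdefmx_unit AWu] := hyp s.
  by rewrite -(mulKmx AWu (Y s)) mulmxDl AY WY addr0 mulmx0.
(* Each block of [u] is [svec (Y s)], hence zero. *)
rewrite -[u](@submxrowK _ _ (fun s => triang #|P s|)).
rewrite -[RHS](@submxrowK _ _ (fun s => triang #|P s|)).
apply: eq_mxrow => s; rewrite submxrow0 -[LHS]smatK -/(Y s) Y0.
by apply/rowP => k; rewrite !mxE /= mxE mulr0.
Qed.
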